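(* If an s-hypersequent $\alpha_1\vdash\beta_1\mid\dots\mid\alpha_n\vdash\beta_n$ is provable in $\mathbf{MPDBL}$, then it is valid in the class $\mathcal{KC}$ of all Kripke contexts.
   Context: The logic PDBL. Variables: object variables $\mathbf{OV}$ ($p,\dots$) and property variables $\mathbf{PV}$ ($P,\dots$), disjoint countably infinite sets; constants $\top,\bot$; connectives $\sqcap,\sqcup$ (binary), $\neg,\lrcorner$ (unary). $\alpha\vee\beta:=\neg(\neg\alpha\sqcap\neg\beta)$, $\alpha\wedge\beta:=\lrcorner(\lrcorner\alpha\sqcup\lrcorner\beta)$. Sequents $\alpha\vdash\beta$ ($\alpha\dashv\vdash\beta$ means both directions); s-hypersequents are finite sequences $\alpha_1\vdash\beta_1\mid\dots\mid\alpha_n\vdash\beta_n$ (components); $B,C,\dots,X$ range over possibly empty s-hypersequents. Axioms: $\alpha\vdash\alpha$; $\alpha\sqcap\beta\vdash\alpha$; $\alpha\sqcap\beta\vdash\beta$; $\alpha\vdash\alpha\sqcup\beta$; $\beta\vdash\alpha\sqcup\beta$; $\alpha\sqcap\beta\vdash(\alpha\sqcap\beta)\sqcap(\alpha\sqcap\beta)$; $(\alpha\sqcup\beta)\sqcup(\alpha\sqcup\beta)\vdash\alpha\sqcup\beta$; $\neg(\alpha\sqcap\alpha)\vdash\neg\alpha$; $\lrcorner\alpha\vdash\lrcorner(\alpha\sqcup\alpha)$; $\alpha\sqcap\neg\alpha\vdash\bot$; $\top\vdash\alpha\sqcup\lrcorner\alpha$; $\neg\neg(\alpha\sqcap\beta)\dashv\vdash\alpha\sqcap\beta$;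 $\lrcorner\lrcorner(\alpha\sqcup\beta)\dashv\vdash\alpha\sqcup\beta$; $\alpha\sqcap\alpha\vdash\alpha\sqcap(\alpha\sqcup\beta)$; $\alpha\sqcup(\alpha\sqcap\beta)\vdash\alpha\sqcup\alpha$; $\alpha\sqcap\alpha\vdash\alpha\sqcap(\alpha\vee\beta)$; $\alpha\sqcup(\alpha\wedge\beta)\vdash\alpha\sqcup\alpha$; $\alpha\sqcap(\beta\vee\gamma)\dashv\vdash(\alpha\sqcap\beta)\vee(\alpha\sqcap\gamma)$; $\alpha\sqcup(\beta\wedge\gamma)\dashv\vdash(\alpha\sqcup\beta)\wedge(\alpha\sqcup\gamma)$; $\bot\vdash\alpha$; $\alpha\vdash\top$; $\neg\top\vdash\bot$; $\top\vdash\lrcorner\bot$; $\neg\bot\dashv\vdash\top\sqcap\top$; $\lrcorner\top\dashv\vdash\bot\sqcup\bot$; $(\alpha\sqcup\alpha)\sqcap(\alpha\sqcup\alpha)\dashv\vdash(\alpha\sqcap\alpha)\sqcup(\alpha\sqcap\alpha)$; $p\sqcap p\dashv\vdash p$ ($p\in\mathbf{OV}$); $P\sqcup P\dashv\vdash P$ ($P\in\mathbf{PV}$); (Sp) $\alpha\vdash\alpha\sqcap\alpha\mid\alpha\sqcup\alpha\vdash\alpha$. Rules: from $B\mid\alpha\vdash\beta\mid C$ infer $B\mid\alpha\sqcap\gamma\vdash\beta\sqcap\gamma\mid C$, $B\mid\gamma\sqcap\alpha\vdash\gamma\sqcap\beta\mid C$, $B\mid\alpha\sqcup\gamma\vdash\beta\sqcup\gamma\mid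 C$, $B\mid\gamma\sqcup\alpha\vdash\gamma\sqcup\beta\mid C$, $B\mid\neg\beta\vdash\neg\alpha\mid C$, $B\mid\lrcorner\beta\vdash\lrcorner\alpha\mid C$; from $B\mid\alpha\vdash\beta\mid C$ and $D\mid\beta\vdash\gamma\mid E$ infer $B\mid D\mid\alpha\vdash\gamma\mid C\mid E$; from $B\mid\alpha\sqcap\beta\vdash\alpha\sqcap\alpha\mid C$, $D\mid\alpha\sqcap\alpha\vdash\alpha\sqcap\beta\mid E$, $F\mid\alpha\sqcup\beta\vdash\beta\sqcup\beta\mid G$, $H\mid\beta\sqcup\beta\vdash\alpha\sqcup\beta\mid X$ infer $B\mid D\mid F\mid H\mid\alpha\vdash\beta\mid C\mid E\mid G\mid X$; external: from $B\mid D\mid D\mid C$ infer $B\mid D\mid C$; from $B\mid D\mid E\mid C$ infer $B\mid E\mid D\mid C$; from $B$ infer $B\mid C$. MPDBL. Add unary connectives $\square,\blacksquare$ (the PDBL schemes and rules range over all formulae of the enlarged language), with additional axioms $\square\alpha\sqcap\square\beta\dashv\vdash\square(\alpha\sqcap\beta)$; $\blacksquare\alpha\sqcup\blacksquare\beta\dashv\vdash\blacksquare(\alpha\sqcup\beta)$; $\square(\neg\bot)\dashv\vdash\neg\bot$; $\blacksquare(\lrcorner\top)\dashv\vdash\lrcorner\top$; $\square(\alpha\sqcap\alpha)\dashv\vdash\square\alpha$; $\blacksquare(\alpha\sqcup\alpha)\dashv\vdash\blacksquare\alpha$, and rules: from $B\mid\alpha\vdash\beta\mid C$ infer $B\mid\square\alpha\vdash\square\beta\mid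 C$ and $B\mid\blacksquare\alpha\vdash\blacksquare\beta\mid C$. Provability is via finite derivations. Kripke contexts and semiconcepts. A Kripke context is $\mathbb{KC}=((G,R),(M,S),I)$ where $(G,M,I)$ is a context ($I\subseteq G\times M$), $R$ is a binary relation on $G$ and $S$ a binary relation on $M$. For $A\subseteq G$, $A'=\{m:gIm\ \forall g\in A\}$; for $B\subseteq M$, $B'=\{g:gIm\ \forall m\in B\}$. A semiconcept of $(G,M,I)$ is a pair $(A,B)$ with $A'=B$ or $B'=A$; $ext(A,B)=A$, $int(A,B)=B$; $\mathfrak{H}$ denotes the set of semiconcepts with operations $(A_1,B_1)\sqcap(A_2,B_2)=(A_1\cap A_2,(A_1\cap A_2)')$, $(A_1,B_1)\sqcup(A_2,B_2)=((B_1\cap B_2)',B_1\cap B_2)$. Models. A model is $\mathbb{M}=(\mathbb{KC},v)$ with $v$ a map on $\mathbf{OV}\cup\mathbf{PV}\cup\{\top,\bot\}$ into $\mathfrak{H}$ with $v(p)\sqcap v(p)=v(p)$ ($p\in\mathbf{OV}$), $v(P)\sqcup v(P)=v(P)$ ($P\in\mathbf{PV}$), $v(\top)=(G,\emptyset)$, $v(\bot)=(\emptyset,M)$. Satisfaction $g\models\alpha$ ($g\in G$) and co-satisfaction $m\succ\alpha$ ($m\in M$): $g\models p$ iff $g\in ext(v(p))$; $g\models P$ iff $g\in ext(v(P))$; $g\models\top$ always; $g\not\models\bot$ always; $m\not\succ\top$ always; $m\succ\bot$ always; $g\models\alpha\sqcap\beta$ iff $g\models\alpha$ and $g\models\beta$;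 $g\models\neg\alpha$ iff $g\not\models\alpha$; $m\succ p$ iff $m\in int(v(p))$; $m\succ P$ iff $m\in int(v(P))$; $m\succ\alpha\sqcup\beta$ iff $m\succ\alpha$ and $m\succ\beta$; $m\succ\lrcorner\alpha$ iff $m\not\succ\alpha$; $g\models\alpha\sqcup\beta$ iff $\forall m(m\succ\alpha\sqcup\beta\Rightarrow gIm)$; $g\models\lrcorner\alpha$ iff $\forall m(m\not\succ\alpha\Rightarrow gIm)$; $m\succ\neg\alpha$ iff $\forall g(g\not\models\alpha\Rightarrow gIm)$; $m\succ\alpha\sqcap\beta$ iff $\forall g(g\models\alpha\sqcap\beta\Rightarrow gIm)$; $g\models\square\alpha$ iff for all $g_1$ with $gRg_1$, $g_1\models\alpha$; $m\succ\square\alpha$ iff $gIm$ for every $g\in G$ such that ($g_1\models\alpha$ for all $g_1$ with $gRg_1$); $m\succ\blacksquare\alpha$ iff for all $m_1$ with $mSm_1$, $m_1\succ\alpha$; $g\models\blacksquare\alpha$ iff $gIm$ for every $m\in M$ such that ($m_1\succ\alpha$ for all $m_1$ with $mSm_1$). A sequent $\alpha\vdash\beta$ is satisfied in $\mathbb{M}$ iff $\forall g(g\models\alpha\Rightarrow g\models\beta)$ and $\forall m(m\succ\beta\Rightarrow m\succ\alpha)$; an s-hypersequent is satisfied iff some component is; true in $\mathbb{KC}$ iff satisfied in every model based on $\mathbb{KC}$; valid in a class iff true in each member. *)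

(* Defs.v *)
From Stdlib Require List.
From mathcomp Require Import all_boot.
From mathcomp Require Import boolp classical_sets.
Set Implicit Arguments.
Unset Strict Implicit.
Unset Printing Implicit Defensive.
Local Open Scope classical_set_scope.

Declare Scope mpdbl_scope.
Delimit Scope mpdbl_scope with mpdbl.

(* The arguments of a valuation: the object variables, the property variables
   (two disjoint copies of nat) and the two constants. *)
Inductive atom :=
  | ObjVar of nat
  | PropVar of nat
  | Top
  | Bot.

Inductive formula :=
  | Atom of atom
  | Meet of formula & formula
  | Join of formula & formula
  | Neg of formula
  | Opp of formula
  | Box of formula
  | BBox of formula.

Notation "⊤" := (Atom Top) (at level 0) : mpdbl_scope.
Notation "⊥" := (Atom Bot) (at level 0) : mpdbl_scope.
Notation "¬ α" := (Neg α) (at level 35, right associativity) : mpdbl_scope.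
Notation "⌟ α" := (Opp α) (at level 35, right associativity) : mpdbl_scope.
Notation "□ α" := (Box α) (at level 35, right associativity) : mpdbl_scope.
Notation "■ α" := (BBox α) (at level 35, right associativity) : mpdbl_scope.
Notation "α ⊓ β" := (Meet α β) (at level 40, left associativity) : mpdbl_scope.
Notation "α ⊔ β" := (Join α β) (at level 40, left associativity) : mpdbl_scope.
Local Open Scope mpdbl_scope.

Definition Vee (α β : formula) : formula := ¬ (¬ α ⊓ ¬ β).
Definition Wedge (α β : formula) : formula := ⌟ (⌟ α ⊔ ⌟ β).

Notation "α ∨ β" := (Vee α β) (at level 40, left associativity) : mpdbl_scope.
Notation "α ∧ β" := (Wedge α β) (at level 40, left associativity) : mpdbl_scope.

Record sequent := Sequent { antecedent : formula; succedent : formula }.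

Notation "α ⊢ β" := (Sequent α β) (at level 65, no associativity) : mpdbl_scope.

(* The separator | is concatenation of lists. The empty list is included
   because the side contexts of the rules may be empty; it is not provable. *)
Definition hypersequent := seq sequent.

Inductive pdbl_axiom : sequent -> Prop :=
  | ax_id α : pdbl_axiom (α ⊢ α)
  | ax_meet_l α β : pdbl_axiom (α ⊓ β ⊢ α)
  | ax_meet_r α β : pdbl_axiom (α ⊓ β ⊢ β)
  | ax_join_l α β : pdbl_axiom (α ⊢ α ⊔ β)
  | ax_join_r α β : pdbl_axiom (β ⊢ α ⊔ β)
  | ax_meet_idem α β : pdbl_axiom (α ⊓ β ⊢ (α ⊓ β) ⊓ (α ⊓ β))
  | ax_join_idem α β : pdbl_axiom ((α ⊔ β) ⊔ (α ⊔ β) ⊢ α ⊔ β)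
  | ax_neg_meet α : pdbl_axiom (¬ (α ⊓ α) ⊢ ¬ α)
  | ax_opp_join α : pdbl_axiom (⌟ α ⊢ ⌟ (α ⊔ α))
  | ax_meet_neg α : pdbl_axiom (α ⊓ ¬ α ⊢ ⊥)
  | ax_join_opp α : pdbl_axiom (⊤ ⊢ α ⊔ ⌟ α)
  | ax_meet_absorb α β : pdbl_axiom (α ⊓ α ⊢ α ⊓ (α ⊔ β))
  | ax_join_absorb α β : pdbl_axiom (α ⊔ (α ⊓ β) ⊢ α ⊔ α)
  | ax_meet_vee α β : pdbl_axiom (α ⊓ α ⊢ α ⊓ (α ∨ β))
  | ax_join_wedge α β : pdbl_axiom (α ⊔ (α ∧ β) ⊢ α ⊔ α)
  | ax_bot α : pdbl_axiom (⊥ ⊢ α)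
  | ax_top α : pdbl_axiom (α ⊢ ⊤)
  | ax_neg_top : pdbl_axiom (¬ ⊤ ⊢ ⊥)
  | ax_opp_bot : pdbl_axiom (⊤ ⊢ ⌟ ⊥).

(* [pdbl_equiv α β] and [modal_equiv α β] stand for the two axioms α ⊢ β and
   β ⊢ α. *)
Inductive pdbl_equiv : formula -> formula -> Prop :=
  | eq_neg_neg α β : pdbl_equiv (¬ ¬ (α ⊓ β)) (α ⊓ β)
  | eq_opp_opp α β : pdbl_equiv (⌟ ⌟ (α ⊔ β)) (α ⊔ β)
  | eq_meet_distr α β γ :
      pdbl_equiv (α ⊓ (β ∨ γ)) ((α ⊓ β) ∨ (α ⊓ γ))
  | eq_join_distr α β γ :
      pdbl_equiv (α ⊔ (β ∧ γ)) ((α ⊔ β) ∧ (α ⊔ γ))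
  | eq_neg_bot : pdbl_equiv (¬ ⊥) (⊤ ⊓ ⊤)
  | eq_opp_top : pdbl_equiv (⌟ ⊤) (⊥ ⊔ ⊥)
  | eq_join_meet α :
      pdbl_equiv ((α ⊔ α) ⊓ (α ⊔ α)) ((α ⊓ α) ⊔ (α ⊓ α))
  | eq_obj p :
      pdbl_equiv (Atom (ObjVar p) ⊓ Atom (ObjVar p)) (Atom (ObjVar p))
  | eq_prop p :
      pdbl_equiv (Atom (PropVar p) ⊔ Atom (PropVar p)) (Atom (PropVar p)).

Inductive modal_equiv : formula -> formula -> Prop :=
  | eq_box_meet α β : modal_equiv (□ α ⊓ □ β) (□ (α ⊓ β))
  | eq_bbox_join α β : modal_equiv (■ α ⊔ ■ β) (■ (α ⊔ β))
  | eq_box_neg_bot : modal_equiv (□ (¬ ⊥)) (¬ ⊥)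
  | eq_bbox_opp_top : modal_equiv (■ (⌟ ⊤)) (⌟ ⊤)
  | eq_box_idem α : modal_equiv (□ (α ⊓ α)) (□ α)
  | eq_bbox_idem α : modal_equiv (■ (α ⊔ α)) (■ α).

Inductive mpdbl_provable : hypersequent -> Prop :=
  | pr_axiom s : pdbl_axiom s -> mpdbl_provable [:: s]
  | pr_equiv α β : pdbl_equiv α β -> mpdbl_provable [:: α ⊢ β]
  | pr_equiv_sym α β : pdbl_equiv α β -> mpdbl_provable [:: β ⊢ α]
  | pr_modal α β : modal_equiv α β -> mpdbl_provable [:: α ⊢ β]
  | pr_modal_sym α β : modal_equiv α β -> mpdbl_provable [:: β ⊢ α]
  | pr_Sp α : mpdbl_provable [:: α ⊢ α ⊓ α; α ⊔ α ⊢ α]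
  | pr_meet_monol B C α β γ :
      mpdbl_provable (B ++ [:: α ⊢ β] ++ C) ->
      mpdbl_provable (B ++ [:: α ⊓ γ ⊢ β ⊓ γ] ++ C)
  | pr_meet_monor B C α β γ :
      mpdbl_provable (B ++ [:: α ⊢ β] ++ C) ->
      mpdbl_provable (B ++ [:: γ ⊓ α ⊢ γ ⊓ β] ++ C)
  | pr_join_monol B C α β γ :
      mpdbl_provable (B ++ [:: α ⊢ β] ++ C) ->
      mpdbl_provable (B ++ [:: α ⊔ γ ⊢ β ⊔ γ] ++ C)
  | pr_join_monor B C α β γ :
      mpdbl_provable (B ++ [:: α ⊢ β] ++ C) ->
      mpdbl_provable (B ++ [:: γ ⊔ α ⊢ γ ⊔ β] ++ C)
  | pr_neg B C α β :
      mpdbl_provable (B ++ [:: α ⊢ β] ++ C) ->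
      mpdbl_provable (B ++ [:: ¬ β ⊢ ¬ α] ++ C)
  | pr_opp B C α β :
      mpdbl_provable (B ++ [:: α ⊢ β] ++ C) ->
      mpdbl_provable (B ++ [:: ⌟ β ⊢ ⌟ α] ++ C)
  | pr_box B C α β :
      mpdbl_provable (B ++ [:: α ⊢ β] ++ C) ->
      mpdbl_provable (B ++ [:: □ α ⊢ □ β] ++ C)
  | pr_bbox B C α β :
      mpdbl_provable (B ++ [:: α ⊢ β] ++ C) ->
      mpdbl_provable (B ++ [:: ■ α ⊢ ■ β] ++ C)
  | pr_trans B C D E α β γ :
      mpdbl_provable (B ++ [:: α ⊢ β] ++ C) ->
      mpdbl_provable (D ++ [:: β ⊢ γ] ++ E) ->
      mpdbl_provable (B ++ D ++ [:: α ⊢ γ] ++ C ++ E)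
  | pr_order B C D E F G H X α β :
      mpdbl_provable (B ++ [:: α ⊓ β ⊢ α ⊓ α] ++ C) ->
      mpdbl_provable (D ++ [:: α ⊓ α ⊢ α ⊓ β] ++ E) ->
      mpdbl_provable (F ++ [:: α ⊔ β ⊢ β ⊔ β] ++ G) ->
      mpdbl_provable (H ++ [:: β ⊔ β ⊢ α ⊔ β] ++ X) ->
      mpdbl_provable (B ++ D ++ F ++ H ++ [:: α ⊢ β] ++ C ++ E ++ G ++ X)
  | pr_contraction B C D :
      mpdbl_provable (B ++ D ++ D ++ C) ->
      mpdbl_provable (B ++ D ++ C)
  | pr_exchange B C D E :
      mpdbl_provable (B ++ D ++ E ++ C) ->
      mpdbl_provable (B ++ E ++ D ++ C)
  | pr_weakening B C :
      mpdbl_provable B ->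
      mpdbl_provable (B ++ C).

Record kripke_context := KripkeContext {
  objects : Type;
  properties : Type;
  object_rel : objects -> objects -> Prop;
  property_rel : properties -> properties -> Prop;
  incidence : objects -> properties -> Prop }.

Section Contexts.
Variable K : kripke_context.
Local Notation G := (objects K).
Local Notation M := (properties K).
Local Notation I := (@incidence K).

Definition common_properties (A : set G) : set M :=
  [set m | forall g, A g -> I g m].

Definition common_objects (B : set M) : set G :=
  [set g | forall m, B m -> I g m].

Definition semiconcept : set (set G * set M) :=
  [set c | common_properties c.1 = c.2 \/ common_objects c.2 = c.1].

Definition semiconcept_meet (c d : set G * set M) : set G * set M :=
  (c.1 `&` d.1, common_properties (c.1 `&` d.1)).

Definition semiconcept_join (c d : set G * set M) : set G * set M :=
  (common_objects (c.2 `&` d.2), c.2 `&` d.2).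

(* The models based on K. *)
Record model := Model {
  valuation : atom -> set G * set M;
  valuation_semiconcept : forall a, semiconcept (valuation a);
  valuation_obj : forall p,
    semiconcept_meet (valuation (ObjVar p)) (valuation (ObjVar p))
      = valuation (ObjVar p);
  valuation_prop : forall p,
    semiconcept_join (valuation (PropVar p)) (valuation (PropVar p))
      = valuation (PropVar p);
  valuation_top : valuation Top = (setT, set0);
  valuation_bot : valuation Bot = (set0, setT) }.

(* The recursion being structural, the clauses of [sat] for ⊔ and ■ and those
   of [cosat] for ⊓ and □ write out the (co-)satisfaction of the formula itself
   instead of calling the other predicate on it. *)
Fixpoint sat (v : model) (α : formula) (g : G) {struct α} : Prop :=
  match α with
  | Atom Top => True
  | Atom Bot => False
  | Atom a => (valuation v a).1 g
  | Meet α1 α2 => sat v α1 g /\ sat v α2 g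
  | Neg α1 => ~ sat v α1 g
  | Join α1 α2 => forall m, cosat v α1 m /\ cosat v α2 m -> I g m
  | Opp α1 => forall m, ~ cosat v α1 m -> I g m
  | Box α1 => forall g1, object_rel g g1 -> sat v α1 g1
  | BBox α1 =>
      forall m, (forall m1, property_rel m m1 -> cosat v α1 m1) -> I g m
  end
with cosat (v : model) (α : formula) (m : M) {struct α} : Prop :=
  match α with
  | Atom Top => False
  | Atom Bot => True
  | Atom a => (valuation v a).2 m
  | Join α1 α2 => cosat v α1 m /\ cosat v α2 m
  | Opp α1 => ~ cosat v α1 m
  | Meet α1 α2 => forall g, sat v α1 g /\ sat v α2 g -> I g m
  | Neg α1 => forall g, ~ sat v α1 g -> I g m
  | BBox α1 => forall m1, property_rel m m1 -> cosat v α1 m1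
  | Box α1 =>
      forall g, (forall g1, object_rel g g1 -> sat v α1 g1) -> I g m
  end.

Definition sequent_satisfied (v : model) (s : sequent) : Prop :=
  (forall g, sat v (antecedent s) g -> sat v (succedent s) g) /\
  (forall m, cosat v (succedent s) m -> cosat v (antecedent s) m).

Definition hypersequent_satisfied (v : model) (H : hypersequent) : Prop :=
  List.Exists (sequent_satisfied v) H.

Definition true_in (H : hypersequent) : Prop :=
  forall v : model, hypersequent_satisfied v H.

End Contexts.

Definition valid (C : set kripke_context) (H : hypersequent) : Prop :=
  forall K, C K -> true_in K H.

Definition all_kripke_contexts : set kripke_context := setT.

(* Main.v *)
(* Every formula α denotes the pair (A, B) of the set A of the objects that
   satisfy α and the set B of the properties that co-satisfy α, and this pair is
   a semiconcept.  In particular A and B are incident, and B = A' or A = B'.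
   If B = A', then inclusion of the extents is enough for α ⊢ γ to be satisfied;
   dually, if γ has extent B' for its intent B, then inclusion of the intents is
   enough.  Most axioms and rules thus reduce to elementary facts about extents
   alone or about intents alone, and the two cases B = A' and A = B' make true
   the first and the second component of (Sp), respectively. *)
Require Import Defs.
From Stdlib Require List.
From mathcomp Require Import all_boot.
From mathcomp Require Import boolp classical_sets.
Set Implicit Arguments.
Unset Strict Implicit.
Unset Printing Implicit Defensive.
Local Open Scope classical_set_scope.
Local Open Scope mpdbl_scope.

Section Soundness.
Variables (K : kripke_context) (v : model K).

(** Only the inclusion of A' in B is required: the converse is incidence of A and B, which holds for
    every formula by [sat_cosat_incidence]. *)
Definition object_determined (α : formula) : Prop :=
  forall m, (forall g, sat v α g -> incidence g m) -> cosat v α m.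

Definition property_determined (α : formula) : Prop :=
  forall g, (forall m, cosat v α m -> incidence g m) -> sat v α g.

(** For a compound formula, one of the two clauses is by definition the derivation of the other;
    atoms rely on the valuation. *)
Lemma semiconcept_denotation α :
  semiconcept (K := K) ([set g | sat v α g], [set m | cosat v α m]).
Proof.
case: α => [a|α β|α β|α|α|α|α]; try by [left | right].
by have := valuation_semiconcept v a; case: a => [p|P||] //;
  rewrite ?valuation_top ?valuation_bot.
Qed.

Lemma sat_cosat_incidence α g m : sat v α g -> cosat v α m -> incidence g m.
Proof.
case: (semiconcept_denotation α) => /seteqP[sub sup] Hg Hm.
  by apply: (sup m).
by apply: (sup g).
Qed.

Lemma object_or_property_determined α :
  object_determined α \/ property_determined α.
Proof.
by case: (semiconcept_denotation α) => /seteqP[sub _];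
  [left=> m /sub | right=> g /sub].
Qed.

(** The intent of a [semiconcept_meet] is the derivation of its extent, and the value of an object
    variable is its own meet with itself. *)
Lemma object_determined_obj p : object_determined (Atom (ObjVar p)).
Proof.
by move=> m /=; rewrite -valuation_obj /= => Hm g [Hg _]; apply: Hm; split.
Qed.

Lemma property_determined_prop P : property_determined (Atom (PropVar P)).
Proof.
by move=> g /=; rewrite -valuation_prop /= => Hg m [Hm _]; apply: Hg; split.
Qed.

Lemma sequent_of_sat α β : object_determined α ->
  (forall g, sat v α g -> sat v β g) -> sequent_satisfied v (α ⊢ β).
Proof.
move=> Oα sub; split=> // m Hm; apply: Oα => g Hg.
exact: sat_cosat_incidence (sub _ Hg) Hm.
Qed.

Lemma sequent_of_cosat α β : property_determined β ->
  (forall m, cosat v β m -> cosat v α m) -> sequent_satisfied v (α ⊢ β).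
Proof.
move=> Pβ sub; split=> // g Hg; apply: Pβ => m Hm.
exact: sat_cosat_incidence Hg (sub _ Hm).
Qed.

Lemma pdbl_axiom_satisfied s : pdbl_axiom s -> sequent_satisfied v s.
Proof.
(* Incidence of extents and intents is the only semiconcept property that these axioms call for. *)
have inc := sat_cosat_incidence.
by case=> *; split=> x; cbn [sat cosat antecedent succedent Vee Wedge];
  firstorder eauto.
Qed.

(** Both sides denote (A'', A') if B = A', and (B', B'') if A = B', since triple derivations
    collapse to single ones. *)
Lemma meet_join_satisfied α :
  sequent_satisfied v ((α ⊔ α) ⊓ (α ⊔ α) ⊢ (α ⊓ α) ⊔ (α ⊓ α)) /\
  sequent_satisfied v ((α ⊓ α) ⊔ (α ⊓ α) ⊢ (α ⊔ α) ⊓ (α ⊔ α)).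
Proof.
have inc := sat_cosat_incidence.
by split; split=> x /=; have [det|det] := object_or_property_determined α;
  firstorder eauto.
Qed.

Lemma pdbl_equiv_satisfied α β : pdbl_equiv α β ->
  sequent_satisfied v (α ⊢ β) /\ sequent_satisfied v (β ⊢ α).
Proof.
case=> {α β} [α β|α β|α β γ|α β γ|||α|p|P].
(* Formulas headed by [⊓], [¬] or [□] are object-determined by definition, those headed by [⊔], [⌟]
   or [■] property-determined, so [//=] discharges determinacy. *)
- by split; apply: sequent_of_sat => //= g; rewrite not_notE.
- by split; apply: sequent_of_cosat => //= m; rewrite not_notE.
- by split; apply: sequent_of_sat => //= g;
    rewrite not_andE !not_notE not_andE !not_notE; tauto.
- by split; apply: sequent_of_cosat => //= m;
    rewrite not_andE !not_notE not_andE !not_notE; tauto.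
- by split; apply: sequent_of_sat => //= g _ [].
- by split; apply: sequent_of_cosat => //= m _ [].
- exact: meet_join_satisfied.
- by split; apply: sequent_of_sat => //=; [|exact: object_determined_obj] => g [].
- by split; apply: sequent_of_cosat => //=;
    [exact: property_determined_prop|] => m [].
Qed.

Lemma modal_equiv_satisfied α β : modal_equiv α β ->
  sequent_satisfied v (α ⊢ β) /\ sequent_satisfied v (β ⊢ α).
Proof.
case=> {α β} [α β|α β|||α|α].
- by split; apply: sequent_of_sat => //= g; firstorder.
- by split; apply: sequent_of_cosat => //= m; firstorder.
- by split; apply: sequent_of_sat => //= g; firstorder.
- by split; apply: sequent_of_cosat => //= m; firstorder.
- by split; apply: sequent_of_sat => //= g; firstorder.
- by split; apply: sequent_of_cosat => //= m; firstorder.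
Qed.

Lemma hypersequent_satisfied_cat B C :
  hypersequent_satisfied v (B ++ C) <->
  hypersequent_satisfied v B \/ hypersequent_satisfied v C.
Proof. exact: List.Exists_app. Qed.

Lemma hypersequent_satisfied1 s :
  hypersequent_satisfied v [:: s] <-> sequent_satisfied v s.
Proof. by split=> [/List.Exists_cons[|/List.Exists_nil] //|]; left. Qed.

Lemma hypersequent_satisfied_replace B C s t :
  (sequent_satisfied v s -> sequent_satisfied v t) ->
  hypersequent_satisfied v (B ++ [:: s] ++ C) ->
  hypersequent_satisfied v (B ++ [:: t] ++ C).
Proof.
rewrite !hypersequent_satisfied_cat !hypersequent_satisfied1; tauto.
Qed.

(** The first premise puts the extent of [α] inside that of [β], the second the intent of [β] inside
    that of [α]. *)
Lemma sequent_satisfied_order α β :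
  sequent_satisfied v (α ⊓ α ⊢ α ⊓ β) ->
  sequent_satisfied v (α ⊔ β ⊢ β ⊔ β) ->
  sequent_satisfied v (α ⊢ β).
Proof.
by move=> [sub _] [_ sup]; split=> [g Hg|m Hm];
  [have [] := sub g | have [] := sup m].
Qed.

Lemma mpdbl_provable_satisfied H :
  mpdbl_provable H -> hypersequent_satisfied v H.
Proof.
elim=> {H}.
- by move=> s /pdbl_axiom_satisfied; left.
- by move=> α β /pdbl_equiv_satisfied[]; left.
- by move=> α β /pdbl_equiv_satisfied[]; left.
- by move=> α β /modal_equiv_satisfied[]; left.
- by move=> α β /modal_equiv_satisfied[]; left.
- move=> α; have [Oα|Pα] := object_or_property_determined α.
    by left; apply: sequent_of_sat.
  by right; left; apply: sequent_of_cosat => // m.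
- move=> B C α β γ _; apply: hypersequent_satisfied_replace => -[sub _].
  by apply: sequent_of_sat => //= g [/sub].
- move=> B C α β γ _; apply: hypersequent_satisfied_replace => -[sub _].
  by apply: sequent_of_sat => //= g [? /sub].
- move=> B C α β γ _; apply: hypersequent_satisfied_replace => -[_ sub].
  by apply: sequent_of_cosat => //= m [/sub].
- move=> B C α β γ _; apply: hypersequent_satisfied_replace => -[_ sub].
  by apply: sequent_of_cosat => //= m [? /sub].
- move=> B C α β _; apply: hypersequent_satisfied_replace => -[sub _].
  by apply: sequent_of_sat => //= g Hβ /sub.
- move=> B C α β _; apply: hypersequent_satisfied_replace => -[_ sub].
  by apply: sequent_of_cosat => //= m Hα /sub.
- move=> B C α β _; apply: hypersequent_satisfied_replace => -[sub _].
  by apply: sequent_of_sat => //= g Hα g1 /Hα /sub.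
- move=> B C α β _; apply: hypersequent_satisfied_replace => -[_ sub].
  by apply: sequent_of_cosat => //= m Hβ m1 /Hβ /sub.
- move=> B C D E α β γ _ IH1 _ IH2; move: IH1 IH2.
  rewrite !hypersequent_satisfied_cat !hypersequent_satisfied1.
  (* A premise satisfied in its side context already satisfies the conclusion; otherwise both active
     sequents hold and compose. *)
  have: sequent_satisfied v (α ⊢ β) -> sequent_satisfied v (β ⊢ γ) ->
      sequent_satisfied v (α ⊢ γ).
    by move=> [? ?] [? ?]; split=> /=; auto.
  tauto.
- move=> B C D E F G H X α β _ _ _ IH1 _ IH2 _ _; move: IH1 IH2.
  rewrite !hypersequent_satisfied_cat !hypersequent_satisfied1.
  have := @sequent_satisfied_order α β; tauto.
- by move=> B C D _; rewrite !hypersequent_satisfied_cat; tauto.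
- by move=> B C D E _; rewrite !hypersequent_satisfied_cat; tauto.
- by move=> B C _; rewrite hypersequent_satisfied_cat; left.
Qed.

End Soundness.

Theorem theorem79 (H : hypersequent) (hH : mpdbl_provable H) :
  valid all_kripke_contexts H.
Proof. by move=> K _ v; apply: mpdbl_provable_satisfied. Qed.
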